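(* Let $\nu>0$ and, for $\epsilon>0$, let $f^{\epsilon}$ be a weak solution of the $\epsilon$-parametrized BGK Boltzmann equation $$\frac{\mathrm{D}}{\mathrm{D}t} f^{\epsilon} = -\frac{1}{3\nu\epsilon^{2}}\left(f^{\epsilon}-M^{\mathrm{eq}}_{f^{\epsilon}}\right)\quad\text{in } I\times\Omega\times\mathbb{R}^{3}$$ with well-defined integral moments $n_{f^{\epsilon}}$ and $\boldsymbol{u}_{f^{\epsilon}}$. Suppose that, understood as functions of $\epsilon$, $$n_{f^{\epsilon}}\in\mathcal{O}(1)\ \text{ in } I\times\Omega,\qquad \boldsymbol{u}_{f^{\epsilon}}\in\mathcal{O}(1)\ \text{ in } I\times\Omega,\qquad w_i\frac{\mathrm{D}}{\mathrm{D}t}f^{\epsilon}\in\mathcal{O}(1)\ \text{ in } I\times\Omega\times Q .$$ Then the family of discrete velocity BGK Boltzmann equations $$\mathcal{FG}=\left(\epsilon^{2}\frac{\mathrm{D}}{\mathrm{D}t}f_i^{\epsilon}+\frac{1}{3\nu}\left(f_i^{\epsilon}-\overline{M}^{\mathrm{eq}}_{\boldsymbol{f}^{\epsilon},i}\right)=0\ \text{ in } I\times\Omega\times Q\right)_{\epsilon>0}$$ is limit consistent of order two in $I\times\Omega\times Q$ to the family of BGK Boltzmann equations $$\mathcal{F}=\left(\epsilon^{2}\frac{\mathrm{D}}{\mathrm{D}t}f^{\epsilon}+\frac{1}{3\nu}\left(f^{\epsilon}-M^{\mathrm{eq}}_{f^{\epsilon}}\right)=0\ \text{ in } I\times\Omega\times\mathbb{R}^{3}\right)_{\epsilon>0};$$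 that is, inserting $f_i^{\epsilon}(t,\boldsymbol{x})=w_i f^{\epsilon}(t,\boldsymbol{x},\boldsymbol{v}_i)$ obtained from the solution $f^{\epsilon}$ of the continuous equation, the truncation error satisfies $$\epsilon^{2}\frac{\mathrm{D}}{\mathrm{D}t}f_i^{\epsilon}+\frac{1}{3\nu}\left(f_i^{\epsilon}-\overline{M}^{\mathrm{eq}}_{\boldsymbol{f}^{\epsilon},i}\right)\in\mathcal{O}(\epsilon^{2})\quad\text{in } I\times\Omega,\qquad i=0,1,\ldots,18.$$
   Context: Setting: $d=3$, $\Omega\subseteq\mathbb{R}^{3}$ is the (periodic) spatial domain, $I\subseteq\mathbb{R}_{\ge 0}$ a time interval, $m>0$ the particle mass, $\boldsymbol{F}\colon I\times\Omega\to\mathbb{R}^{3}$ a given force, and $\frac{\mathrm{D}}{\mathrm{D}t}=\partial_t+\boldsymbol{v}\cdot\nabla_{\boldsymbol{x}}+\frac{\boldsymbol{F}}{m}\cdot\nabla_{\boldsymbol{v}}$. A distribution is a function $f\colon I\times\Omega\times\mathbb{R}^{3}\to\mathbb{R}_{>0}$ with moments $n_f=\int_{\mathbb{R}^{3}}f\,\mathrm{d}\boldsymbol{v}$ and $\boldsymbol{u}_f=\frac{1}{n_f}\int_{\mathbb{R}^{3}}\boldsymbol{v}f\,\mathrm{d}\boldsymbol{v}$. The $\epsilon$-parametrized Maxwellian is $$M_f^{\mathrm{eq}}(t,\boldsymbol{x},\boldsymbol{v})=\frac{n_f\,\epsilon^{d}}{(\tfrac23\pi)^{d/2}}\exp\left(-\tfrac32\left(\boldsymbol{v}\epsilon-\boldsymbol{u}_f\epsilon\right)^{2}\right).$$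 Discrete velocities: $Q=\{\boldsymbol{v}_0,\ldots,\boldsymbol{v}_{q-1}\}$, $q=19$ (the $D3Q19$ stencil), where $\epsilon\boldsymbol{v}_0=(0,0,0)^{\mathrm T}$, $\epsilon\boldsymbol{v}_1,\ldots,\epsilon\boldsymbol{v}_6$ are the vectors $(\pm1,0,0)^{\mathrm T},(0,\pm1,0)^{\mathrm T},(0,0,\pm1)^{\mathrm T}$, and $\epsilon\boldsymbol{v}_7,\ldots,\epsilon\boldsymbol{v}_{18}$ are the vectors $(0,\pm1,\pm1)^{\mathrm T},(\pm1,\pm1,0)^{\mathrm T},(\pm1,0,\pm1)^{\mathrm T}$. Put $\widetilde{\boldsymbol{v}}_i=\epsilon\boldsymbol{v}_i$ and $w=w(\widetilde{\boldsymbol{v}}_i)=(\tfrac23\pi)^{d/2}\epsilon^{-d}\exp(\tfrac32\widetilde{\boldsymbol{v}}_i^{2})$. The weights are $w_i=\tfrac13 w$ for $i=0$, $w_i=\tfrac1{18}w$ for $i=1,\ldots,6$, $w_i=\tfrac1{36}w$ for $i=7,\ldots,18$. Discrete quantities: $f_i^{\epsilon}(t,\boldsymbol{x})=w_i f^{\epsilon}(t,\boldsymbol{x},\boldsymbol{v}_i)$, $n_{\boldsymbol{f}^{\epsilon}}=\sum_{i=0}^{q-1}f_i^{\epsilon}$, $\boldsymbol{u}_{\boldsymbol{f}^{\epsilon}}=\frac{1}{n_{\boldsymbol{f}^{\epsilon}}}\sum_{i=0}^{q-1}\boldsymbol{v}_i f_i^{\epsilon}$, and $$\overline{M}^{\mathrm{eq}}_{\boldsymbol{f}^{\epsilon},i}=\frac{w_i}{w}n_{\boldsymbol{f}^{\epsilon}}\left[1+3\epsilon^{2}\boldsymbol{v}_i\cdot\boldsymbol{u}_{\boldsymbol{f}^{\epsilon}}-\tfrac32\epsilon^{2}\boldsymbol{u}_{\boldsymbol{f}^{\epsilon}}^{2}+\tfrac92\epsilon^{4}(\boldsymbol{v}_i\cdot\boldsymbol{u}_{\boldsymbol{f}^{\epsilon}})^{2}\right].$$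 Here $\frac{\mathrm{D}}{\mathrm{D}t}f_i^{\epsilon}$ means $w_i\left(\frac{\mathrm{D}}{\mathrm{D}t}f^{\epsilon}\right)(t,\boldsymbol{x},\boldsymbol{v}_i)$. Landau symbols are with respect to $\epsilon\searrow0$, at points of the indicated sets; a statement ''in $I\times\Omega\times Q$'' means for all $(t,\boldsymbol{x})\in I\times\Omega$ with velocity evaluated at $\boldsymbol{v}_i$, $i=0,\ldots,q-1$. Limit consistency: let a family of equations $\mathcal{A}^{\epsilon}=(A^{\epsilon}(\cdot)=0)_{\epsilon>0}$ with solutions $a^{\epsilon}$ have a limit as $\epsilon\searrow0$ (in a formal, weak or strong sense) to a solution $c$ of a target PDE $\mathcal{C}$, with formal order $r$, meaning $A^{\epsilon}(c)\in\mathcal{O}(\epsilon^{r})$. A discretized family $\mathcal{B}^{\epsilon}_h=(B_h^{\epsilon}(\cdot)=0)$ on $X_h\subseteq X$ is limit consistent of order $k>0$ to $\mathcal{A}^{\epsilon}$ if the truncation error satisfies $B_h^{\epsilon}(a^{\epsilon}|_{X_h})\in\mathcal{O}(h^{k})$ and $k\ge r$. Here the discretization parameter is coupled with $\epsilon$ ($h=\epsilon$), the target PDE is the incompressible Navier--Stokes system, and the background order of the limit of $\mathcal{F}$ is taken to be $r=2$. *)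

(* Defs.v *)
(* MathComp / MathComp-Analysis, over an arbitrary R : realType. *)
From HB Require Import structures.
From mathcomp Require Export all_boot all_order all_algebra.
From mathcomp Require Export all_classical all_reals all_analysis.

Set Implicit Arguments.
Unset Strict Implicit.
Unset Printing Implicit Defensive.

Export Order.TTheory GRing.Theory Num.Theory.
Export numFieldNormedType.Exports.

Local Open Scope classical_set_scope.
Local Open Scope ring_scope.

Definition dot {R : realType} (u v : 'rV[R]_3) : R := \sum_(j < 3) u 0 j * v 0 j.

Definition basisv {R : realType} (j : 'I_3) : 'rV[R]_3 := delta_mx 0 j.

(* The library has no Lebesgue measure on row vectors: integrals over R^3 are
   taken over R * R * R with the product Lebesgue measure, through rv3. *)
Definition rv3 {R : realType} (p : R * R * R) : 'rV[R]_3 :=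
  \row_(j < 3) [:: p.1.1; p.1.2; p.2]`_j.

Definition leb3 (R : realType) : {measure set _ -> \bar R} :=
  ((@lebesgue_measure R \x @lebesgue_measure R) \x @lebesgue_measure R)%E.
Arguments leb3 R : clear implicits.

(* On ((x, t), v_0, v_1, v_2), left-nested: the library infers no
   sigma-finite structure for a product, so it cannot be a right factor. *)
Definition leb7 (R : realType) : {measure set _ -> \bar R} :=
  ((((leb3 R \x @lebesgue_measure R) \x @lebesgue_measure R)
     \x @lebesgue_measure R) \x @lebesgue_measure R)%E.
Arguments leb7 R : clear implicits.

(* Points (t, x, v). *)
Definition phase (R : realType) : Type := (R * 'rV[R]_3 * 'rV[R]_3)%type.

Definition ph7 {R : realType} (z : R * R * R * R * R * R * R) : phase R :=
  (z.1.1.1.2, rv3 z.1.1.1.1, rv3 (z.1.1.2, z.1.2, z.2)).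

(* The periodic domain is given by its fundamental cell, the half-open box with
   corners a and b; periodicity is carried by the test functions below. *)
Definition cell {R : realType} (a b : 'rV[R]_3) : set 'rV[R]_3 :=
  [set x | forall j, a 0 j <= x 0 j < b 0 j].

Definition kdomain {R : realType} (I : set R) (Om : set 'rV[R]_3) : set (phase R) :=
  (I `*` Om) `*` setT.

Definition iter_derive {R : realType} (ds : seq (R * 'rV[R]_3 * 'rV[R]_3))
    (phi : R * 'rV[R]_3 * 'rV[R]_3 -> R) : R * 'rV[R]_3 * 'rV[R]_3 -> R :=
  foldr (fun d g z => 'D_d g z) phi ds.

Definition smooth {R : realType} (phi : R * 'rV[R]_3 * 'rV[R]_3 -> R) : Prop :=
  forall ds z, differentiable (iter_derive ds phi) z.

Definition test_function {R : realType} (I : set R) (a b : 'rV[R]_3)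
    (phi : R * 'rV[R]_3 * 'rV[R]_3 -> R) : Prop :=
  [/\ smooth phi,
      forall t x v (j : 'I_3),
        phi (t, x + (b 0 j - a 0 j) *: basisv j, v) = phi (t, x, v) &
      exists (K : set R) (V : set 'rV[R]_3),
        [/\ compact K, K `<=` I°, compact V &
            forall t x v, phi (t, x, v) != 0 -> K t /\ V v]].

(* d/dt + v . grad_x + (F / m) . grad_v *)
Definition material_derivative {R : realType} (m : R) (F : R -> 'rV[R]_3 -> 'rV[R]_3)
    (phi : R * 'rV[R]_3 * 'rV[R]_3 -> R) (z : R * 'rV[R]_3 * 'rV[R]_3) : R :=
  let: (t, x, v) := z in
  'D_((1, 0, 0) : R * 'rV[R]_3 * 'rV[R]_3) phi z
  + \sum_(j < 3) v 0 j * 'D_((0, basisv j, 0) : R * 'rV[R]_3 * 'rV[R]_3) phi z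
  + \sum_(j < 3)
      (F t x 0 j / m) * 'D_((0, 0, basisv j) : R * 'rV[R]_3 * 'rV[R]_3) phi z.

(* g is the weak material derivative of f. The operator is formally
   skew-adjoint because F does not depend on v. *)
Definition weak_material_derivative {R : realType} (m : R)
    (F : R -> 'rV[R]_3 -> 'rV[R]_3) (I : set R) (a b : 'rV[R]_3)
    (f g : phase R -> R) : Prop :=
  let D := [set z | kdomain I (cell a b) (ph7 z)] in
  forall phi, test_function I a b phi ->
    [/\ (leb7 R).-integrable D
          (fun z => (f (ph7 z) * material_derivative m F phi (ph7 z))%:E),
        (leb7 R).-integrable D (fun z => (g (ph7 z) * phi (ph7 z))%:E) &
        \int[leb7 R]_(z in D) (g (ph7 z) * phi (ph7 z))
        = - \int[leb7 R]_(z in D)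
              (f (ph7 z) * material_derivative m F phi (ph7 z))].

Definition moments_defined {R : realType} (I : set R) (Om : set 'rV[R]_3)
    (f : phase R -> R) : Prop :=
  forall t x, I t -> Om x ->
    (leb3 R).-integrable setT (fun y => (f (t, x, rv3 y))%:E) /\
    forall j : 'I_3,
      (leb3 R).-integrable setT (fun y => (rv3 y 0 j * f (t, x, rv3 y))%:E).

Definition density {R : realType} (f : phase R -> R) (t : R) (x : 'rV[R]_3) : R :=
  \int[leb3 R]_y f (t, x, rv3 y).

Definition velocity {R : realType} (f : phase R -> R) (t : R) (x : 'rV[R]_3) : 'rV[R]_3 :=
  (density f t x)^-1 *: \row_(j < 3) \int[leb3 R]_y (rv3 y 0 j * f (t, x, rv3 y)).

Definition maxwellian {R : realType} (eps : R) (f : phase R -> R) (z : phase R) : R :=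
  let: (t, x, v) := z in
  let c := eps *: v - eps *: velocity f t x in
  density f t x * eps ^+ 3 / (2 / 3 * pi) `^ (3 / 2) * expR (- (3 / 2) * dot c c).

(* Df is the weak material derivative of f, in the representative for which the
   equation holds at every point of I x Omega x R^3; the moments of f, hence the
   right-hand side, are pointwise defined, so such a representative exists as soon
   as the equation holds in the weak sense. This is what gives Df a value at the
   discrete velocities, a null set. *)
Definition bgk_weak_solution {R : realType} (m : R) (F : R -> 'rV[R]_3 -> 'rV[R]_3)
    (nu : R) (I : set R) (a b : 'rV[R]_3) (eps : R) (f Df : phase R -> R) : Prop :=
  weak_material_derivative m F I a b f Df /\
  forall z, kdomain I (cell a b) z ->
    Df z = - (1 / (3 * nu * eps ^+ 2)) * (f z - maxwellian eps f z).

(* State variables are pairs: a function and its material derivative. *)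
Definition bgk_residual {R : realType} (nu eps : R)
    (s : (phase R -> R) * (phase R -> R)) (z : phase R) : R :=
  eps ^+ 2 * s.2 z + 1 / (3 * nu) * (s.1 z - maxwellian eps s.1 z).

Definition stencil_seq : seq (int * int * int) :=
  [:: (0, 0, 0);
      (1, 0, 0); (-1, 0, 0); (0, 1, 0); (0, -1, 0); (0, 0, 1); (0, 0, -1);
      (0, 1, 1); (0, 1, -1); (0, -1, 1); (0, -1, -1);
      (1, 1, 0); (1, -1, 0); (-1, 1, 0); (-1, -1, 0);
      (1, 0, 1); (1, 0, -1); (-1, 0, 1); (-1, 0, -1)].

(* The rescaled velocities eps * v_i. *)
Definition stencil {R : realType} (i : 'I_19) : 'rV[R]_3 :=
  let c := nth (0, 0, 0) stencil_seq i in rv3 (c.1.1%:~R, c.1.2%:~R, c.2%:~R).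

Definition dvel {R : realType} (eps : R) (i : 'I_19) : 'rV[R]_3 := eps^-1 *: stencil i.

Definition wfun {R : realType} (eps : R) (c : 'rV[R]_3) : R :=
  (2 / 3 * pi) `^ (3 / 2) * eps ^- 3 * expR (3 / 2 * dot c c).

Definition weight {R : realType} (eps : R) (i : 'I_19) : R :=
  (if i == 0%N :> nat then 1 / 3 else if (i <= 6)%N then 1 / 18 else 1 / 36)
  * wfun eps (stencil i).

(* g : populations, g i t x = g_i(t, x). *)
Definition ddensity {R : realType} (g : 'I_19 -> R -> 'rV[R]_3 -> R)
    (t : R) (x : 'rV[R]_3) : R := \sum_(i < 19) g i t x.

Definition dvelocity {R : realType} (eps : R) (g : 'I_19 -> R -> 'rV[R]_3 -> R)
    (t : R) (x : 'rV[R]_3) : 'rV[R]_3 :=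
  (ddensity g t x)^-1 *: \sum_(i < 19) g i t x *: dvel eps i.

Definition dmaxwellian {R : realType} (eps : R) (g : 'I_19 -> R -> 'rV[R]_3 -> R)
    (i : 'I_19) (t : R) (x : 'rV[R]_3) : R :=
  let u := dvelocity eps g t x in
  weight eps i / wfun eps (stencil i) * ddensity g t x *
  (1 + 3 * eps ^+ 2 * dot (dvel eps i) u - 3 / 2 * eps ^+ 2 * dot u u
   + 9 / 2 * eps ^+ 4 * dot (dvel eps i) u ^+ 2).

Definition dbgk_residual {R : realType} (nu eps : R)
    (s : ('I_19 -> R -> 'rV[R]_3 -> R) * ('I_19 -> R -> 'rV[R]_3 -> R))
    (z : R * 'rV[R]_3 * 'I_19) : R :=
  let: (t, x, i) := z in
  eps ^+ 2 * s.2 i t x + 1 / (3 * nu) * (s.1 i t x - dmaxwellian eps s.1 i t x).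

Definition discretize {R : realType} (eps : R) (s : (phase R -> R) * (phase R -> R)) :
    ('I_19 -> R -> 'rV[R]_3 -> R) * ('I_19 -> R -> 'rV[R]_3 -> R) :=
  (fun i t x => weight eps i * s.1 (t, x, dvel eps i),
   fun i t x => weight eps i * s.2 (t, x, dvel eps i)).

(* The discretization parameter is h = eps. The equations are given by residuals A, B evaluated at the points of D, Dh;
   sol are the solutions of A, rest restricts them to the discrete state space,
   and r is the formal order with which A tends to its target equation. Landau
   symbols are pointwise in the points of Dh. *)
Definition limit_consistent {R : realType} (X Xh P Ph : Type)
    (A : R -> X -> P -> R) (D : set P) (sol : R -> X) (r : nat)
    (B : R -> Xh -> Ph -> R) (Dh : set Ph) (rest : R -> X -> Xh) (k : nat) : Prop :=
  [/\ forall eps, 0 < eps -> forall p, D p -> A eps (sol eps) p = 0,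
      forall p, Dh p ->
        (fun eps : R => B eps (rest eps (sol eps)) p) =O_ (0^'+)
        (fun eps : R => eps ^+ k),
      (0 < k)%N & (r <= k)%N].

(* Main.v *)
Require Import Defs.
From mathcomp Require Import ring lra.

(** The equation holds pointwise for the chosen representative of the material
    derivative, so [f = M - 3 nu eps^2 Df], where [M] is the Maxwellian of [f].
    At a lattice velocity the weight cancels the factor
    [exp (- 3/2 |c_i|^2)] of [M], where [c_i] is the rescaled velocity, which
    leaves (lemma [weight_maxwellian])
      [lattice_weight i * n * exp (3 eps c_i.u - 3/2 eps^2 |u|^2)].
    Since [n], [u] and the weighted [Df] are [O(1)], the populations are
      [g_i = lattice_weight i * n * (1 + 3 eps c_i.u) + O(eps^2)].

    The lattice moments of order 0, 1 and 2 are those of the Maxwellian, so the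
    discrete mass [r] and the discrete flux [J] (the sum of the [g_i c_i]) are
    [r = n + O(eps^2)] and [J = eps n u + O(eps^2)].
    Hence the constant and linear parts of the discrete Maxwellian
      [lattice_weight i * r * (1 + 3 c_i.q - 3/2 |q|^2 + 9/2 (c_i.q)^2)],
    with [q = J / r], agree with those of [g_i] up to [O(eps^2)].

    The quadratic part needs more care: it consists of terms [(w.J)^2 / r], and
    the density is bounded above but may tend to 0 with [eps].
    Positivity of the populations gives [|w.J| <= C r], which handles
    [r <= eps^2]; for [r > eps^2] the error terms are themselves controlled by
    [r], and the expansion of [J] suffices (lemma [order_eps_sqr_div]).  So the
    collision term [g_i - discrete Maxwellian] is [O(eps^2)]
    (lemma [order_eps_collision]), as is [eps^2] times the weighted [Df], and
    these two add up to the truncation error. *)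

Local Open Scope classical_set_scope.
Local Open Scope ring_scope.

(** * Functions of order eps ^+ k at 0 from the right *)

Definition order_eps {R : realType} (k : nat) (h : R -> R) : Prop :=
  h =O_ (0^'+) (fun e : R => e ^+ k).

(** Written without the absolute value of [e ^+ k], which is positive on the
    filter considered. *)
Lemma order_epsP {R : realType} {k : nat} {h : R -> R} :
  order_eps k h <->
  exists2 K, 0 < K & \forall e \near 0^'+, `|h e| <= K * e ^+ k.
Proof.
split.
- move=> /eqO_exP[K K0 hK]; exists K => //.
  near=> e.
  have e0 : 0 < e by near: e; exact: nbhs_right_gt.
  rewrite -[e in e ^+ _](gtr0_norm e0) -normrX.
  by near: e.
- case=> K K0 hK; apply/eqO_exP; exists K => //.
  near=> e.
  have e0 : 0 < e by near: e; exact: nbhs_right_gt.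
  rewrite normrX (gtr0_norm e0).
  by near: e.
Unshelve. all: by end_near.
Qed.

Lemma order_eps_near {R : realType} {k : nat} {g h : R -> R} :
  (\forall e \near 0^'+, h e = g e) -> order_eps k g -> order_eps k h.
Proof.
move=> hg /order_epsP[K K0 gK]; apply/order_epsP; exists K => //.
by apply: filterS2 hg gK => e ->.
Qed.

Lemma order_eps_pos {R : realType} {k : nat} {g h : R -> R} :
  (forall e, 0 < e -> h e = g e) -> order_eps k g -> order_eps k h.
Proof.
move=> hg; apply: order_eps_near.
by near=> e; apply: hg; near: e; exact: nbhs_right_gt.
Unshelve. all: by end_near.
Qed.

Lemma order_epsD {R : realType} {k : nat} {g h : R -> R} :
  order_eps k g -> order_eps k h -> order_eps k (fun e => g e + h e).
Proof. by rewrite /order_eps => -> ->; exact: addO. Qed.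

Lemma order_epsM {R : realType} {k l : nat} {g h : R -> R} :
  order_eps k g -> order_eps l h -> order_eps (k + l) (fun e => g e * h e).
Proof.
move=> /order_epsP[K K0 gK] /order_epsP[L L0 hL]; apply/order_epsP.
exists (K * L); first exact: mulr_gt0.
apply: filterS2 gK hL => e gK hL.
by rewrite normrM exprD mulrACA ler_pM.
Qed.

Lemma order_eps_weaken {R : realType} {k l : nat} {h : R -> R} :
  (l <= k)%N -> order_eps k h -> order_eps l h.
Proof.
move=> lk /order_epsP[K K0 hK]; apply/order_epsP; exists K => //.
near=> e.
have e0 : 0 < e by near: e; exact: nbhs_right_gt.
have e1 : e <= 1 by near: e; exact: nbhs_right_le.
apply: (@le_trans _ _ (K * e ^+ k)); first by near: e.
by rewrite ler_pM2l// ler_wiXn2l// ltW.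
Unshelve. all: by end_near.
Qed.

Lemma order_eps_cst {R : realType} (c : R) : order_eps 0 (fun=> c).
Proof.
apply/order_epsP; exists (`|c| + 1); first by rewrite ltr_wpDl.
by near=> e; rewrite expr0 mulr1 lerDl.
Unshelve. all: by end_near.
Qed.

Lemma order_epsZ {R : realType} {k : nat} (c : R) {h : R -> R} :
  order_eps k h -> order_eps k (fun e => c * h e).
Proof. exact: order_epsM (order_eps_cst c). Qed.

Lemma order_epsB {R : realType} {k : nat} {g h : R -> R} :
  order_eps k g -> order_eps k h -> order_eps k (fun e => g e - h e).
Proof.
move=> gk hk; apply: order_epsD => //.
by apply: order_eps_pos (order_epsZ (-1) hk) => e _; rewrite mulN1r.
Qed.

Lemma order_eps_exp {R : realType} k : order_eps k (fun e : R => e ^+ k).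
Proof.
apply/order_epsP; exists 1 => //.
by near=> e; rewrite mul1r normrX ger0_norm.
Unshelve. all: by end_near.
Qed.

Lemma order_eps_sum {R : realType} {J : finType} {k : nat} {h : J -> R -> R} :
  (forall j, order_eps k (h j)) -> order_eps k (fun e => \sum_j h j e).
Proof.
move=> hk; have -> : (fun e => \sum_j h j e) = \sum_j h j.
  by apply/funext => e; rewrite fct_sumE.
elim/big_ind : _ => [|g1 g2|j _]; [|exact: order_epsD|exact: hk].
by apply: order_eps_pos (order_epsZ 0 (order_eps_exp k)) => e _; rewrite mul0r.
Qed.

(** Both bounds come from [1 + x <= expR x]: at [y] it gives the sign, and at
    [- y] it gives [expR y <= 1 / (1 - y)], whose second-order remainder is
    [y ^+ 2 / (1 - y)]. *)
Lemma expR_sub1_sub_le {R : realType} {y : R} : y <= 1 / 2 ->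
  `|expR y - 1 - y| <= 2 * y ^+ 2.
Proof.
move=> y2; have lo := expR_ge1Dx y; have hi := expR_ge1Dx (- y).
have e1 : expR y * expR (- y) = 1 by rewrite -expRD subrr expR0.
rewrite ger0_norm; last by lra.
have e0 := expR_gt0 y.
have up : expR y * (1 - y) <= 1 by rewrite -[leRHS]e1 ler_pM2l.
have y1 : 0 < 1 - y by lra.
suff : expR y <= 1 + y + 2 * y ^+ 2 by lra.
rewrite -(ler_pM2r y1); apply: le_trans up _.
suff : 0 <= y ^+ 2 * (1 - 2 * y) by lra.
by rewrite mulr_ge0 ?sqr_ge0//; lra.
Qed.

Lemma order_eps_expR {R : realType} {y : R -> R} :
  order_eps 1 y -> order_eps 2 (fun e => expR (y e) - 1 - y e).
Proof.
move=> /order_epsP[K K0 yK]; apply/order_epsP.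
exists (2 * K ^+ 2); first by rewrite mulr_gt0// exprn_gt0.
near=> e.
have e0 : 0 < e by near: e; exact: nbhs_right_gt.
have eK : e <= (2 * K)^-1.
  by near: e; apply: nbhs_right_le; rewrite invr_gt0 mulr_gt0.
have yKe : `|y e| <= K * e by near: e.
have Ke : K * e <= 1 / 2.
  apply: le_trans (ler_wpM2l (ltW K0) eK) _.
  by rewrite invfM mulrCA divff ?gt_eqF// mulr1 div1r.
have yh : y e <= 1 / 2 by apply: le_trans (ler_norm _) (le_trans yKe Ke).
apply: le_trans (expR_sub1_sub_le yh) _.
rewrite -mulrA ler_pM2l// -exprMn -real_normK ?num_real//.
by rewrite lerXn2r ?nnegrE// mulr_ge0// ltW.
Unshelve. all: by end_near.
Qed.

(** * The D3Q19 lattice *)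

(** The weights of the quadrature rule, that is [w_i / w]. *)
Definition lattice_weight {R : realType} (i : 'I_19) : R :=
  if i == 0%N :> nat then 1 / 3 else if (i <= 6)%N then 1 / 18 else 1 / 36.

Lemma sum_lattice_weight (R : realType) : \sum_i lattice_weight i = 1 :> R.
Proof. by rewrite /lattice_weight !big_ord_recl big_ord0 /=; field. Qed.

Lemma dotC {R : realType} (w u : 'rV[R]_3) : dot w u = dot u w.
Proof. by apply: eq_bigr => j _; rewrite mulrC. Qed.

Lemma dot_rv3 {R : realType} (w : 'rV[R]_3) (p : R * R * R) :
  dot w (rv3 p) = w 0 0 * p.1.1 + w 0 1 * p.1.2 + w 0 2 * p.2.
Proof.
rewrite /dot !big_ord_recl big_ord0 /= !mxE /= addr0 addrA.
by congr (_ * _ + w _ _ * _ + w _ _ * _); apply/val_inj.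
Qed.

Lemma sum_lattice_weight_dot {R : realType} (w : 'rV[R]_3) :
  \sum_i lattice_weight i * dot w (stencil i) = 0.
Proof.
rewrite /lattice_weight /stencil.
under eq_bigr do rewrite dot_rv3.
rewrite !big_ord_recl big_ord0 /=.
by field.
Qed.

(** The second lattice moment is isotropic, with squared sound speed 1/3; this
    is the reason for the factor 3 in the linear term of the equilibrium. *)
Lemma sum_lattice_weight_dot2 {R : realType} (w u : 'rV[R]_3) :
  \sum_i lattice_weight i * (dot w (stencil i) * dot (stencil i) u)
  = dot w u / 3.
Proof.
have -> : dot w u = w 0 0 * u 0 0 + w 0 1 * u 0 1 + w 0 2 * u 0 2.
  rewrite -(dot_rv3 w (u 0 0, u 0 1, u 0 2)); congr dot.
  by apply/rowP => -[[|[|[|//]]] ?]; rewrite mxE /=; congr (u _ _); apply/val_inj.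
rewrite /lattice_weight /stencil.
under eq_bigr do rewrite (dotC _ u) !dot_rv3.
rewrite !big_ord_recl big_ord0 /=.
by field.
Qed.

Lemma dotZr {R : realType} c (w u : 'rV[R]_3) : dot w (c *: u) = c * dot w u.
Proof. by rewrite mulr_sumr; apply: eq_bigr => j _; rewrite mxE mulrCA. Qed.

Lemma dotZl {R : realType} c (w u : 'rV[R]_3) : dot (c *: w) u = c * dot w u.
Proof. by rewrite dotC dotZr dotC. Qed.

Lemma dot_sumr {R : realType} (J : finType) (w : 'rV[R]_3) (h : J -> 'rV[R]_3) :
  dot w (\sum_j h j) = \sum_j dot w (h j).
Proof.
rewrite exchange_big; apply: eq_bigr => k _.
by rewrite summxE mulr_sumr.
Qed.

(** * Populations close to the linearized equilibrium *)

Definition flux {R : realType} (g : 'I_19 -> R) : 'rV[R]_3 :=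
  \sum_i g i *: stencil i.

Lemma dot_flux {R : realType} (w : 'rV[R]_3) (g : 'I_19 -> R) :
  dot w (flux g) = \sum_i g i * dot w (stencil i).
Proof. by rewrite dot_sumr; apply: eq_bigr => i _; rewrite dotZr. Qed.

Definition near_linear_equilibrium {R : realType} (n : R -> R) (u : R -> 'rV[R]_3)
    (g : 'I_19 -> R -> R) : Prop :=
  forall i, order_eps 2
    (fun e => g i e - lattice_weight i * n e * (1 + 3 * e * dot (stencil i) (u e))).

(** The linear term carries no mass because the first lattice moment vanishes. *)
Lemma order_eps_mass {R : realType} {n : R -> R} {u : R -> 'rV[R]_3}
    {g : 'I_19 -> R -> R} :
  near_linear_equilibrium n u g -> order_eps 2 (fun e => \sum_i g i e - n e).
Proof.
move=> gE; apply: order_eps_pos (order_eps_sum gE) => e _.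
rewrite sumrB; congr (_ - _).
transitivity (n e * (\sum_i lattice_weight i)
              + 3 * e * n e * \sum_i lattice_weight i * dot (u e) (stencil i)).
  by rewrite sum_lattice_weight sum_lattice_weight_dot mulr0 addr0 mulr1.
rewrite !mulr_sumr -big_split.
by apply: eq_bigr => i _; rewrite (dotC (u e)) /=; ring.
Qed.

(** Stated in each direction [w], since the quadratic terms of the equilibrium
    are squares of directional fluxes. *)
Lemma order_eps_flux {R : realType} {n : R -> R} {u : R -> 'rV[R]_3}
    {g : 'I_19 -> R -> R} (w : 'rV[R]_3) :
  near_linear_equilibrium n u g ->
  order_eps 2 (fun e => dot w (flux (g^~ e)) - n e * e * dot w (u e)).
Proof.
move=> gE.
have /order_eps_sum : forall i, order_eps 2 (fun e => dot w (stencil i) *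
    (g i e - lattice_weight i * n e * (1 + 3 * e * dot (stencil i) (u e)))).
  by move=> i; apply: order_epsZ.
apply: order_eps_pos => e _; rewrite dot_flux.
under [RHS]eq_bigr => i _ do rewrite mulrBr (mulrC _ (g i e)).
rewrite sumrB; congr (_ - _).
transitivity (n e * (\sum_i lattice_weight i * dot w (stencil i))
    + 3 * e * n e *
      \sum_i lattice_weight i * (dot w (stencil i) * dot (stencil i) (u e))).
  by rewrite sum_lattice_weight_dot sum_lattice_weight_dot2; field.
rewrite !mulr_sumr -big_split.
by apply: eq_bigr => i _ /=; ring.
Qed.

(** Here [r] is the mass and [j] a component of the flux.  There is no lower
    bound on [r], so the quotient is estimated in two regimes.  If
    [r <= eps ^+ 2], then [j ^+ 2 / r <= C ^+ 2 * r].  If [r > eps ^+ 2], then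
    [|n| <= (1 + A) * r] and [eps ^+ 4 <= eps ^+ 2 * r], so both parts of
    [j ^+ 2], from [n * eps * v] and from the error, are at most a multiple of
    [eps ^+ 2 * r]. *)
Lemma order_eps_sqr_div {R : realType} (C : R) (r j n v : R -> R) :
  (\forall e \near 0^'+, 0 < r e) -> (\forall e \near 0^'+, `|j e| <= C * r e) ->
  order_eps 0 n -> order_eps 0 v ->
  order_eps 2 (fun e => r e - n e) -> order_eps 2 (fun e => j e - n e * e * v e) ->
  order_eps 2 (fun e => j e ^+ 2 / r e).
Proof.
move=> r_gt0 j_le /order_epsP[N N0 n_le] /order_epsP[V V0 v_le] /order_epsP[A A0 rn_le].
move=> /order_epsP[B B0 jnv_le]; apply/order_epsP.
(* The first summand serves the regime r <= eps ^+ 2, the second the other. *)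
exists (C ^+ 2 + 2 * (N * (1 + A) * V ^+ 2 + B ^+ 2)).
  rewrite ltr_wpDl ?sqr_ge0// mulr_gt0// addr_gt0// ?exprn_gt0//.
  by rewrite !mulr_gt0 ?exprn_gt0// addr_gt0.
near=> e.
have e0 : 0 < e by near: e; exact: nbhs_right_gt.
have r0 : 0 < r e by near: e.
have jr : `|j e| <= C * r e by near: e.
have nN : `|n e| <= N by rewrite -[N]mulr1 -(expr0 e); near: e.
have vV : `|v e| <= V by rewrite -[V]mulr1 -(expr0 e); near: e.
have rnA : `|r e - n e| <= A * e ^+ 2 by near: e.
have jB : `|j e - n e * e * v e| <= B * e ^+ 2 by near: e.
have e20 : 0 < e ^+ 2 by rewrite exprn_gt0.
rewrite ger0_norm ?divr_ge0 ?sqr_ge0 ?(ltW r0)// ler_pdivrMr//.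
have [re|re] := leP (r e) (e ^+ 2).
  apply: (@le_trans _ _ (C ^+ 2 * r e ^+ 2)).
    by rewrite -exprMn -real_normK ?num_real// lerXn2r ?nnegrE// (le_trans _ jr).
  have rr : C ^+ 2 * r e ^+ 2 <= C ^+ 2 * (e ^+ 2 * r e).
    by rewrite ler_wpM2l ?sqr_ge0// expr2 ler_pM2r.
  have := ltW r0; have := ltW e20; have := ltW N0; have := ltW A0 => *.
  have : 0 <= 2 * (N * (1 + A) * V ^+ 2 + B ^+ 2) * (e ^+ 2 * r e).
    by do ?[exact: sqr_ge0 | exact: ler0n | exact: ler01 | apply: mulr_ge0 | apply: addr_ge0].
  lra.
have nr : `|n e| <= (1 + A) * r e.
  apply: (@le_trans _ _ (r e + A * e ^+ 2)).
    rewrite -[n e](subKr (r e)); apply: le_trans (ler_normB _ _) _.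
    by rewrite gtr0_norm// lerD2l.
  by rewrite mulrDl mul1r lerD2l ler_pM2l// ltW.
have n2 : n e ^+ 2 <= N * (1 + A) * r e.
  by rewrite -real_normK ?num_real// expr2 -mulrA ler_pM.
have v2 : v e ^+ 2 <= V ^+ 2.
  by rewrite -real_normK ?num_real// lerXn2r ?nnegrE// ltW.
have nv2 : n e ^+ 2 * v e ^+ 2 <= N * (1 + A) * r e * V ^+ 2.
  by rewrite ler_pM ?sqr_ge0.
have d2 : (j e - n e * e * v e) ^+ 2 <= B ^+ 2 * (e ^+ 2 * r e).
  apply: (@le_trans _ _ ((B * e ^+ 2) ^+ 2)).
    by rewrite -real_normK ?num_real// lerXn2r ?nnegrE// mulr_ge0// ltW.
  by rewrite exprMn ler_wpM2l ?sqr_ge0// (expr2 (e ^+ 2)) ler_pM2l// ltW.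
have sq : j e ^+ 2 <= 2 * (j e - n e * e * v e) ^+ 2
                      + 2 * (e ^+ 2 * (n e ^+ 2 * v e ^+ 2)).
  (* The instance of 2 * x ^+ 2 + 2 * y ^+ 2 - (x + y) ^+ 2 = (x - y) ^+ 2 with
     x + y = j e. *)
  have := sqr_ge0 (j e - 2 * (n e * e * v e)).
  lra.
have env : e ^+ 2 * (n e ^+ 2 * v e ^+ 2) <= e ^+ 2 * (N * (1 + A) * r e * V ^+ 2).
  by rewrite ler_pM2l.
have C0 : 0 <= C ^+ 2 * (e ^+ 2 * r e).
  by rewrite mulr_ge0 ?sqr_ge0// mulr_ge0 ?sqr_ge0// ltW.
lra.
Unshelve. all: by end_near.
Qed.

(** As the populations are positive, the flux divided by the mass is a convex
    combination of the lattice velocities, hence bounded. *)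
Lemma order_eps_flux_sqr {R : realType} {n : R -> R} {u : R -> 'rV[R]_3}
    {g : 'I_19 -> R -> R} (w : 'rV[R]_3) :
  (forall i e, 0 < e -> 0 < g i e) -> order_eps 0 n ->
  (forall v, order_eps 0 (fun e => dot v (u e))) -> near_linear_equilibrium n u g ->
  order_eps 2 (fun e => dot w (flux (g^~ e)) ^+ 2 / \sum_i g i e).
Proof.
move=> g0 nO uO gE.
have near0 (P : R -> Prop) : (forall e, 0 < e -> P e) -> \forall e \near 0^'+, P e.
  by move=> P0; near=> e; apply: P0; near: e; exact: nbhs_right_gt.
apply: (order_eps_sqr_div (\sum_i `|dot w (stencil i)|) _ _ n (fun e => dot w (u e))).
- apply: near0 => e e0; rewrite big_ord_recl ltr_pwDl ?g0// sumr_ge0// => i _.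
  by rewrite ltW ?g0.
- apply: near0 => e e0; rewrite dot_flux; apply: le_trans (ler_norm_sum _ _ _) _.
  rewrite mulr_suml; apply: ler_sum => i _.
  rewrite normrM mulrC ler_wpM2l// gtr0_norm ?g0//.
  by rewrite (bigD1 i)//= lerDl sumr_ge0// => l _; rewrite ltW ?g0.
- exact: nO.
- exact: uO.
- exact: order_eps_mass gE.
- exact: order_eps_flux w gE.
Unshelve. all: by end_near.
Qed.

(** The discrete Maxwellian in the rescaled mean velocity [q], the product of
    [eps] and the discrete velocity; in this form [eps] no longer appears. *)
Definition quadratic_equilibrium {R : realType} (g : 'I_19 -> R) (i : 'I_19) : R :=
  let r := \sum_l g l in
  let q := r^-1 *: flux g in
  lattice_weight i * r *
  (1 + 3 * dot (stencil i) q - 3 / 2 * dot q q + 9 / 2 * dot (stencil i) q ^+ 2).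

(** After cancellation the collision term is a combination of the errors in the
    populations, the mass and the flux along [stencil i], and of the quadratic
    terms, each of which is small. *)
Lemma order_eps_collision {R : realType} {n : R -> R} {u : R -> 'rV[R]_3}
    {g : 'I_19 -> R -> R} (i : 'I_19) :
  (forall i e, 0 < e -> 0 < g i e) -> order_eps 0 n ->
  (forall v, order_eps 0 (fun e => dot v (u e))) -> near_linear_equilibrium n u g ->
  order_eps 2 (fun e => g i e - quadratic_equilibrium (g^~ e) i).
Proof.
move=> g0 nO uO gE.
pose J e := flux (g^~ e); pose r e := \sum_l g l e; pose W : R := lattice_weight i.
have massO : order_eps 2 (fun e => W * (r e - n e)).
  exact: order_epsZ (order_eps_mass gE).
have fluxO : order_eps 2 (fun e =>
    3 * W * (dot (stencil i) (J e) - n e * e * dot (stencil i) (u e))).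
  exact: order_epsZ (order_eps_flux (stencil i) gE).
have JJO : order_eps 2 (fun e =>
    3 / 2 * W * \sum_(k < 3) (dot (basisv k) (J e) ^+ 2 / r e)).
  apply: order_epsZ; apply: order_eps_sum => k.
  exact: order_eps_flux_sqr (basisv k) g0 nO uO gE.
have cJO : order_eps 2 (fun e => 9 / 2 * W * (dot (stencil i) (J e) ^+ 2 / r e)).
  by apply: order_epsZ; exact: order_eps_flux_sqr (stencil i) g0 nO uO gE.
apply: order_eps_pos (order_epsB (order_epsD (order_epsB (order_epsB (gE i) massO)
  fluxO) JJO) cJO) => e e0.
have r0 : r e != 0.
  rewrite gt_eqF// /r big_ord_recl ltr_pwDl ?g0// sumr_ge0// => l _.
  by rewrite ltW ?g0.
have -> : \sum_(k < 3) (dot (basisv k) (J e) ^+ 2 / r e) = dot (J e) (J e) / r e.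
  rewrite -mulr_suml; congr (_ / _); apply: eq_bigr => k _; rewrite expr2.
  suff -> : dot (basisv k) (J e) = J e 0 k by [].
  rewrite /dot (bigD1 k)//= big1 ?addr0 => [|l lk]; rewrite !mxE ?eqxx ?mul1r//.
  by rewrite (negbTE lk) mul0r.
rewrite /quadratic_equilibrium -/(r e) -/(J e) -/W.
by rewrite !(dotZl, dotZr); field; exact: r0.
Qed.

(** * From the kinetic equation to the populations *)

Lemma weightE {R : realType} (eps : R) (i : 'I_19) :
  weight eps i = lattice_weight i * wfun eps (stencil i).
Proof. by []. Qed.

Lemma wfun_gt0 {R : realType} (eps : R) (c : 'rV[R]_3) : 0 < eps -> 0 < wfun eps c.
Proof.
move=> e0; rewrite /wfun !mulr_gt0 ?expR_gt0 ?invr_gt0 ?exprn_gt0// powR_gt0//.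
by rewrite mulr_gt0 ?pi_gt0//.
Qed.

Lemma weight_gt0 {R : realType} (eps : R) (i : 'I_19) : 0 < eps -> 0 < weight eps i.
Proof.
move=> e0; rewrite weightE mulr_gt0 ?wfun_gt0// /lattice_weight.
by case: ifP => _ //; case: ifP.
Qed.

Lemma dot_sub {R : realType} (c d : 'rV[R]_3) :
  dot (c - d) (c - d) = dot c c - 2 * dot c d + dot d d.
Proof. by rewrite /dot !big_ord_recl !big_ord0 !mxE; ring. Qed.

(** Completing the square: the weight removes the factor of the Gaussian that
    depends on the lattice velocity alone, and every normalization. *)
Lemma weight_maxwellian {R : realType} (eps : R) (f : phase R -> R) (i : 'I_19)
    (t : R) (x : 'rV[R]_3) : 0 < eps ->
  weight eps i * maxwellian eps f (t, x, dvel eps i) =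
  lattice_weight i * density f t x *
  expR (3 * eps * dot (stencil i) (velocity f t x)
        - 3 / 2 * eps ^+ 2 * dot (velocity f t x) (velocity f t x)).
Proof.
move=> e0; rewrite /maxwellian; move: (velocity f t x) => u.
have e1 : eps != 0 by rewrite gt_eqF.
have p0 : (2 / 3 * pi : R) `^ (3 / 2) != 0.
  by rewrite gt_eqF// powR_gt0// mulr_gt0// pi_gt0.
have -> : 3 * eps * dot (stencil i) u - 3 / 2 * eps ^+ 2 * dot u u =
    3 / 2 * dot (stencil i) (stencil i)
    + - (3 / 2) * dot (stencil i - eps *: u) (stencil i - eps *: u).
  by rewrite dot_sub !(dotZl, dotZr); field.
rewrite expRD weightE /wfun /dvel scalerA divff// scale1r.
by field; rewrite e1 p0.
Qed.

Lemma discrete_maxwellianE {R : realType} (eps : R)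
    (g : 'I_19 -> R -> 'rV[R]_3 -> R) (i : 'I_19) (t : R) (x : 'rV[R]_3) :
  0 < eps ->
  dmaxwellian eps g i t x = quadratic_equilibrium (fun l => g l t x) i.
Proof.
move=> e0; have e1 : eps != 0 by rewrite gt_eqF.
have w0 : wfun eps (stencil i) != 0 by rewrite gt_eqF ?wfun_gt0.
rewrite /dmaxwellian /quadratic_equilibrium /ddensity weightE mulfK//.
set u := dvelocity eps g t x; set r := \sum_l g l t x.
have -> : r^-1 *: flux (fun l => g l t x) = eps *: u.
  rewrite /u /dvelocity scalerA mulrC -scalerA; congr (_ *: _).
  rewrite scaler_sumr; apply: eq_bigr => l _.
  by rewrite /dvel !scalerA; congr (_ *: _); field.
clearbody u; rewrite /dvel !(dotZl, dotZr).
by congr (_ * _); field.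
Qed.

Lemma order_eps_entry {R : realType} {u : R -> 'rV[R]_3} (k : 'I_3) :
  u =O_ (0^'+) (fun=> 1 : R) -> order_eps 0 (fun e => u e 0 k).
Proof.
move=> /eqO_exP[K K0 uK]; apply/order_epsP; exists K => //.
apply: filterS uK => e; rewrite expr0 normr1 => uK; apply: le_trans _ uK.
by rewrite [leRHS]/Num.norm /= mx_normrE; apply/bigmax_geP; right => /=; exists (0, k).
Qed.

Theorem theorem3 (R : realType) (I : set R) (a b : 'rV[R]_3) (m nu : R)
    (F : R -> 'rV[R]_3 -> 'rV[R]_3) (f Df : R -> phase R -> R)
    (I_itv : is_interval I) (I_ge0 : I `<=` [set t | 0 <= t])
    (ab : forall j, a 0 j < b 0 j) (m_gt0 : 0 < m) (nu_gt0 : 0 < nu)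
    (f_gt0 : forall eps, 0 < eps ->
       forall z, kdomain I (cell a b) z -> 0 < f eps z)
    (f_moments : forall eps, 0 < eps -> moments_defined I (cell a b) (f eps))
    (f_sol : forall eps, 0 < eps ->
       bgk_weak_solution m F nu I a b eps (f eps) (Df eps))
    (density_O1 : forall t x, I t -> cell a b x ->
       (fun eps : R => density (f eps) t x) =O_ (0^'+) (fun=> 1 : R))
    (velocity_O1 : forall t x, I t -> cell a b x ->
       (fun eps : R => velocity (f eps) t x) =O_ (0^'+) (fun=> 1 : R))
    (Df_O1 : forall t x (i : 'I_19), I t -> cell a b x ->
       (fun eps : R => weight eps i * Df eps (t, x, dvel eps i)) =O_ (0^'+)
       (fun=> 1 : R)) :
  limit_consistent
    (bgk_residual nu) (kdomain I (cell a b)) (fun eps => (f eps, Df eps)) 2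
    (dbgk_residual nu) ((I `*` cell a b) `*` setT) discretize 2.
Proof.
split=> //.
  move=> eps e0 z Dz; rewrite /bgk_residual /= (proj2 (f_sol eps e0) z Dz).
  by field; rewrite !gt_eqF.
move=> [[t x] i] [[It Omx] _].
pose n e := density (f e) t x; pose u e := velocity (f e) t x.
pose g l e := weight e l * f e (t, x, dvel e l).
have nO : order_eps 0 n := density_O1 t x It Omx.
have uO k := order_eps_entry k (velocity_O1 t x It Omx).
have duO v : order_eps 0 (fun e => dot v (u e)).
  by apply: order_eps_sum => k; apply: order_epsZ.
have DfO l : order_eps 2 (fun e => e ^+ 2 * (weight e l * Df e (t, x, dvel e l))).
  have DfO : order_eps 0 (fun e => weight e l * Df e (t, x, dvel e l)).
    exact: Df_O1.
  exact: order_epsM (order_eps_exp 2) DfO.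
have dom e l : kdomain I (cell a b) (t, x, dvel e l) by [].
have g_gt0 l e : 0 < e -> 0 < g l e.
  by move=> e0; rewrite mulr_gt0 ?weight_gt0 ?f_gt0.
have gE : near_linear_equilibrium n u g.
  move=> l.
  pose y e := 3 * e * dot (stencil l) (u e) - 3 / 2 * e ^+ 2 * dot (u e) (u e).
  (* The part of y of order 2 is moved to the remainder of the exponential. *)
  have uuO : order_eps 2 (fun e => 3 / 2 * e ^+ 2 * dot (u e) (u e)).
    apply: order_epsM (order_epsZ (3 / 2) (order_eps_exp 2)) _.
    by apply: order_eps_sum => k; exact: order_epsM (uO k) (uO k).
  have yO : order_eps 1 y.
    apply: order_epsB (order_eps_weaken _ uuO) => //.
    exact: order_epsM (order_epsZ 3 (order_eps_exp 1)) (duO _).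
  have expO := order_epsB (order_eps_expR yO) uuO.
  apply: order_eps_pos (order_epsB (order_epsZ (lattice_weight l)
    (order_epsM nO expO)) (order_epsZ (3 * nu) (DfO l))) => e e0.
  (* By the equation, the term in Df is exactly the difference between the
     population and the weighted Maxwellian. *)
  rewrite (proj2 (f_sol e e0) _ (dom e l)) /g.
  have -> : weight e l * (- (1 / (3 * nu * e ^+ 2)) *
      (f e (t, x, dvel e l) - maxwellian e (f e) (t, x, dvel e l))) =
      - (1 / (3 * nu * e ^+ 2)) * (weight e l * f e (t, x, dvel e l)
        - weight e l * maxwellian e (f e) (t, x, dvel e l)) by ring.
  rewrite weight_maxwellian// -/(n e) -/(u e) -/(y e).
  have -> : 3 * e * dot (stencil l) (u e)
    = y e + 3 / 2 * e ^+ 2 * dot (u e) (u e) by rewrite subrK.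
  by field; rewrite !gt_eqF.
apply: order_eps_pos (order_epsD (DfO i) (order_epsZ (1 / (3 * nu))
  (order_eps_collision i g_gt0 nO duO gE))) => e e0.
by rewrite /dbgk_residual discrete_maxwellianE.
Qed.
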